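(* Fix $0<p<1$ and define, for bounded operators $T$ on $L^2(\mu_p)$, $$\Psi(T)=P_\phi+pU_0TU_0^*+(1-p)U_2TU_2^*.$$ Then: (1) for every $m\ge0$, $K_{m+1}=\Psi(K_m)$, and in particular $K_m=\Psi^m(P_\phi)$; (2) $K_\infty=\Psi(K_\infty)$, i.e. $K_\infty=P_\phi+pU_0K_\infty U_0^*+(1-p)U_2K_\infty U_2^*$; (3) $K_\infty$ is the unique bounded operator $T$ on $L^2(\mu_p)$ satisfying $T=\Psi(T)$.
   Context: Let $S_0(x)=x/3$, $S_2(x)=(x+2)/3$ on $[0,1]$ and let $C$ be the middle-third Cantor set. For $0<p<1$, $\mu_p$ is the unique Borel probability measure on $[0,1]$ with $\mu_p=p\,\mu_p\circ S_0^{-1}+(1-p)\,\mu_p\circ S_2^{-1}$. For words $w\in\{0,2\}^n$, $S_w=S_{w_1}\circ\cdots\circ S_{w_n}$, $C_w=S_w(C)$. Inner product $\langle f,g\rangle=\int\overline fg\,d\mu_p$; $\phi=1_C$ and $P_\phi f=\langle\phi,f\rangle\phi$. $K_mf=\sum_{|u|\le m}\langle1_{C_u},f\rangle1_{C_u}$ and $K_\infty=\lim_{m\to\infty}K_m$ in operator norm (this limit exists). $U_0,U_2$ are defined by $(U_0f)(x)=p^{-1/2}1_{C_0}(x)f(S_0^{-1}(x))$, $(U_2f)(x)=(1-p)^{-1/2}1_{C_2}(x)f(S_2^{-1}(x))$. *)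

(* Defs.v *)
From HB Require Import structures.
From mathcomp Require Import all_boot all_order all_algebra.
From mathcomp Require Import all_classical all_reals all_analysis.
From mathcomp.real_closed Require Import complex.
Set Implicit Arguments. Unset Strict Implicit. Unset Printing Implicit Defensive.
Import Order.TTheory GRing.Theory Num.Theory.
Local Open Scope classical_set_scope.
Local Open Scope ring_scope.
Local Open Scope complex_scope.

Section Cantor.
Variable R : realType.

(* the two similitudes: b = false <-> S_0, b = true <-> S_2 *)
Definition S (b : bool) (x : R) : R := if b then (x + 2) / 3 else x / 3.
Definition Sw (w : seq bool) : R -> R := foldr (fun b g => S b \o g) id w.
Definition Cantor : set R :=
  [set x | forall n : nat, exists w : seq bool, size w = n /\ (Sw w @` `[0, 1]) x].
Definition Cw (w : seq bool) : set R := Sw w @` Cantor.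
End Cantor.

Section Hilbert.
Context (R : realType) (mu : {measure set R -> \bar R}).
Local Notation C := (R[i]).

Definition sqnorm (z : C) : R := complex.Re z ^+ 2 + complex.Im z ^+ 2.

Definition L2 (f : R -> C) : Prop :=
  measurable_fun setT (fun x => complex.Re (f x)) /\
  measurable_fun setT (fun x => complex.Im (f x)) /\
  mu.-integrable setT (fun x => (sqnorm (f x))%:E).

Definition L2norm (f : R -> C) : R := Num.sqrt (Rintegral mu setT (fun x => sqnorm (f x))).

Definition ip (f g : R -> C) : C :=
  Complex (Rintegral mu setT (fun x => complex.Re (conjc (f x) * g x)))
          (Rintegral mu setT (fun x => complex.Im (conjc (f x) * g x))).

Definition ae_eq (f g : R -> C) : Prop := {ae mu, forall x, f x = g x}.

(* operators are maps on functions; they are compared on L^2 modulo mu-a.e. equality *)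
Definition op := (R -> C) -> (R -> C).

Definition op_eq (A B : op) : Prop := forall f, L2 f -> ae_eq (A f) (B f).

Definition bounded_op (T : op) : Prop :=
  [/\ (forall f, L2 f -> L2 (T f)),
      (forall f g, L2 f -> L2 g -> ae_eq f g -> ae_eq (T f) (T g)),
      (forall (a : C) f g, L2 f -> L2 g ->
          ae_eq (T (fun x => a * f x + g x)) (fun x => a * T f x + T g x))
    & (exists c : R, forall f, L2 f -> L2norm (T f) <= c * L2norm f)].

Definition is_adjoint (T Ts : op) : Prop :=
  bounded_op Ts /\ forall f g, L2 f -> L2 g -> ip (T f) g = ip f (Ts g).

Definition opnorm_cvg (K : nat -> op) (Kinf : op) : Prop :=
  forall e : R, 0 < e -> exists N : nat, forall m, (N <= m)%N ->
    forall f, L2 f -> L2norm (fun x => K m f x - Kinf f x) <= e * L2norm f.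

Definition phi : R -> C := \1_(@Cantor R).

Definition Pphi : op := fun f x => ip phi f * phi x.

Definition K (m : nat) : op := fun f x =>
  \sum_(k < m.+1) \sum_(u : k.-tuple bool)
     ip (\1_(Cw (tval u))) f * (\1_(Cw (tval u)) x : C).

Definition U0 (p : R) : op := fun f x =>
  ((Num.sqrt p)^-1)%:C * \1_(Cw [:: false]) x * f (3 * x).
Definition U2 (p : R) : op := fun f x =>
  ((Num.sqrt (1 - p))^-1)%:C * \1_(Cw [:: true]) x * f (3 * x - 2).

Definition Psi (p : R) (U0s U2s : op) (T : op) : op := fun f x =>
  Pphi f x + p%:C * U0 p (T (U0s f)) x + (1 - p)%:C * U2 p (T (U2s f)) x.

End Hilbert.

(* Main.v *)
(* Every estimate is made on squared norms.  Self-similarity of [mu] makes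
   [U_b] a contraction, so that with [A = |U0* f|^2 + |U2* f|^2] and
   [h = U0 (U0* f) + U2 (U2* f)] one has [A = Re <f, h>] and [|h|^2 <= A] (the
   ranges of [U0] and [U2] are orthogonal), whence [A <= |f|^2].  Consequently, if
   [|T1 f - T2 f|^2 <= M |f|^2] for all [f], then [Psi T1 - Psi T2] satisfies the
   same bound with [M] multiplied by [max(p, 1-p)^2 <= 1 - p (1-p) < 1]: [Psi] is
   a strict contraction.  This gives uniqueness, and it lets [K_(m+1) = Psi K_m]
   pass to the limit.  The recursion itself holds pointwise, since [U_b 1_(C_v)] is
   a multiple of [1_(C_(bv))]. *)
Require Import Defs.
From HB Require Import structures.
From mathcomp Require Import all_boot all_order all_algebra.
From mathcomp Require Import all_classical all_reals all_analysis.
From mathcomp Require Import measurable_realfun.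
From mathcomp.real_closed Require Import complex.
From mathcomp Require Import ring lra.
Set Implicit Arguments. Unset Strict Implicit. Unset Printing Implicit Defensive.
Import Order.TTheory GRing.Theory Num.Theory.
Local Open Scope classical_set_scope.
Local Open Scope ring_scope.

(** * Cylinder sets of the Cantor set: measurability, nesting, disjointness *)

Section Cantor_sets.
Variable R : realType.

Definition Sinv (b : bool) (x : R) : R := if b then 3 * x - 2 else 3 * x.

Lemma SK b : cancel (@S R b) (Sinv b).
Proof. by case: b => x; rewrite /S /Sinv; field. Qed.

Lemma SinvK b : cancel (Sinv b) (@S R b).
Proof. by case: b => x; rewrite /S /Sinv; field. Qed.

Lemma image_S b (A : set R) : S b @` A = Sinv b @^-1` A.
Proof.
apply/seteqP; split=> [_ [x Ax <-] /=|x Ax]; first by rewrite SK.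
by exists (Sinv b x) => //; rewrite SinvK.
Qed.

Lemma measurable_S b : measurable_fun setT (@S R b).
Proof.
case: b; rewrite /S; apply: measurable_funM => //.
by apply: measurable_funD.
Qed.

Lemma measurable_Sinv b : measurable_fun setT (Sinv b).
Proof.
case: b; rewrite /Sinv; last exact: measurable_funM.
by apply: measurable_funB => //; exact: measurable_funM.
Qed.

Lemma measurable_image_S b (A : set R) : measurable A -> measurable (S b @` A).
Proof.
move=> mA; rewrite image_S -[X in measurable X]setTI.
exact: measurable_Sinv.
Qed.

Lemma image_Sw_cons b w (A : set R) : Sw (b :: w) @` A = S b @` (Sw w @` A).
Proof. by rewrite -image_comp. Qed.

Lemma measurable_image_Sw w (A : set R) : measurable A -> measurable (Sw w @` A).
Proof.
move=> mA; elim: w => [|b w IH]; first by rewrite image_id.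
by rewrite image_Sw_cons; exact: measurable_image_S.
Qed.

(** Words of length [n] are taken as tuples, a finite type, so each level is a finite union and the
    whole set a countable intersection of measurable sets. *)
Lemma Cantor_bigcap : @Cantor R =
  \bigcap_n \bigcup_(w : n.-tuple bool) Sw w @` `[0, 1].
Proof.
apply/seteqP; split=> [x Cx n _|x Cx n].
  have [w [sw xw]] := Cx n; have sw' : size w == n by apply/eqP.
  by exists (Tuple sw').
by have [w _ xw] := Cx n I; exists w; rewrite size_tuple.
Qed.

Lemma measurable_Cantor : measurable (@Cantor R).
Proof.
rewrite Cantor_bigcap; apply: bigcapT_measurable => n.
apply: fin_bigcup_measurable => [|w _]; first exact: finite_finset.
exact: measurable_image_Sw.
Qed.

Lemma measurable_Cw w : measurable (@Cw R w).
Proof. exact: measurable_image_Sw measurable_Cantor. Qed.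

Lemma Cantor_sub01 : @Cantor R `<=` `[0, 1].
Proof. by move=> x /(_ 0%N)[w [/size0nil-> [y y01 <-]]]. Qed.

Lemma S_01 b (x : R) : x \in `[0, 1] -> S b x \in `[0, 1].
Proof. by rewrite !in_itv /S; case: b => /=; lra. Qed.

(** Prefixing [b] to a word of length [n] that works for [x] gives one of length [n + 1] for
    [S b x]; level 0 is just the invariance of the unit interval. *)
Lemma image_S_Cantor b : S b @` @Cantor R `<=` @Cantor R.
Proof.
move=> _ [x Cx <-] [|n].
  by exists [::]; split => //; exists (S b x) => //; exact/S_01/Cantor_sub01.
have [w [sw xw]] := Cx n; exists (b :: w); split; first by rewrite /= sw.
by rewrite image_Sw_cons; exists x.
Qed.

Lemma Cw_nil : @Cw R [::] = @Cantor R.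
Proof. exact: image_id. Qed.

Lemma Cw_cons b w : @Cw R (b :: w) = S b @` @Cw R w.
Proof. exact: image_Sw_cons. Qed.

Lemma Cw_sub_Cantor w : @Cw R w `<=` @Cantor R.
Proof.
elim: w => [|b w IH]; first by rewrite Cw_nil.
by rewrite Cw_cons; apply: subset_trans (@image_S_Cantor b); exact: image_subset.
Qed.

Lemma Cw1_sub01 b : @Cw R [:: b] `<=` S b @` `[0, 1].
Proof. by rewrite Cw_cons Cw_nil; apply/image_subset/Cantor_sub01. Qed.

Lemma Cw_cons_sub b w : @Cw R (b :: w) `<=` @Cw R [:: b].
Proof. by rewrite !Cw_cons Cw_nil; apply/image_subset/Cw_sub_Cantor. Qed.

(** One of the two points is at most 1/3, the other at least 2/3. *)
Lemma image_S_disjoint b (x y : R) : x \in `[0, 1] -> y \in `[0, 1] ->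
  S b x <> S (~~ b) y.
Proof. by rewrite !in_itv /S; case: b => /=; lra. Qed.

End Cantor_sets.

Definition weight (R : realType) (p : R) (b : bool) : R := if b then 1 - p else p.

(** A single family indexed by the letter, convertible to [U0 p] at [false] and to [U2 p] at [true],
    so that each argument is made once. *)
Definition Ub (R : realType) (p : R) (b : bool) : op R := fun f x =>
  ((Num.sqrt (weight p b))^-1)%:C%C * \1_(Cw [:: b]) x * f (Sinv b x).

(** * Pointwise inequalities for the squared modulus *)

Section Complex_squared_norm.
Variable R : realType.
Implicit Types z w : R[i].

Lemma ReD z w : complex.Re (z + w) = complex.Re z + complex.Re w.
Proof. by case: z; case: w. Qed.

Lemma ImD z w : complex.Im (z + w) = complex.Im z + complex.Im w.
Proof. by case: z; case: w. Qed.

Lemma ReM z w :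
  complex.Re (z * w) = complex.Re z * complex.Re w - complex.Im z * complex.Im w.
Proof. by case: z; case: w. Qed.

Lemma ImM z w :
  complex.Im (z * w) = complex.Re z * complex.Im w + complex.Im z * complex.Re w.
Proof. by case: z; case: w. Qed.

Lemma Re_conjc z : complex.Re (conjc z) = complex.Re z.
Proof. by case: z. Qed.

Lemma Im_conjc z : complex.Im (conjc z) = - complex.Im z.
Proof. by case: z. Qed.

Lemma Re_indic (A : set R) x : complex.Re (\1_A x : R[i]) = \1_A x.
Proof. by rewrite !indicE; case: (x \in A). Qed.

Lemma Im_indic (A : set R) x : complex.Im (\1_A x : R[i]) = 0.
Proof. by rewrite !indicE; case: (x \in A). Qed.

Lemma sqnorm_ge0 z : 0 <= sqnorm z.
Proof. by rewrite addr_ge0 ?sqr_ge0. Qed.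

Lemma sqnorm0 : sqnorm (0 : R[i]) = 0.
Proof. by rewrite /sqnorm /= expr0n addr0. Qed.

Lemma sqnorm_eq0 z : sqnorm z = 0 -> z = 0.
Proof.
case: z => a b /eqP; rewrite paddr_eq0 ?sqr_ge0// !sqrf_eq0 /=.
by case/andP=> /eqP -> /eqP ->.
Qed.

Lemma sqnormM z w : sqnorm (z * w) = sqnorm z * sqnorm w.
Proof. rewrite /sqnorm ReM ImM; ring. Qed.

Lemma sqnormN z : sqnorm (- z) = sqnorm z.
Proof. by case: z => a b; rewrite /sqnorm /= !sqrrN. Qed.

Lemma sqnorm_real (a : R) : sqnorm (a%:C%C) = a ^+ 2.
Proof. by rewrite /sqnorm /= expr0n addr0. Qed.

Lemma sqnorm_indic (A : set R) x : sqnorm (\1_A x : R[i]) = \1_A x.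
Proof. by rewrite /sqnorm Re_indic Im_indic indicE; case: (x \in A) => /=; ring. Qed.

(** The parallelogram law with the term [sqnorm (z - w)] dropped. *)
Lemma sqnormD_le z w : sqnorm (z + w) <= 2 * sqnorm z + 2 * sqnorm w.
Proof.
case: z w => [a b] [c d]; rewrite /sqnorm /=.
by have := sqr_ge0 (a - c); have := sqr_ge0 (b - d); nra.
Qed.

(** With its imaginary counterpart, a crude majorant that makes the integrand of [ip] integrable. *)
Lemma norm_Re_conjM z w : `|complex.Re (conjc z * w)| <= sqnorm z + sqnorm w.
Proof.
rewrite ReM Re_conjc Im_conjc; case: z w => [a b] [c d]; rewrite /sqnorm /= ler_norml.
have := sqr_ge0 (a - c); have := sqr_ge0 (a + c).
by have := sqr_ge0 (b - d); have := sqr_ge0 (b + d); nra.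
Qed.

Lemma norm_Im_conjM z w : `|complex.Im (conjc z * w)| <= sqnorm z + sqnorm w.
Proof.
rewrite ImM Re_conjc Im_conjc; case: z w => [a b] [c d]; rewrite /sqnorm /= ler_norml.
have := sqr_ge0 (a - d); have := sqr_ge0 (a + d).
by have := sqr_ge0 (b - c); have := sqr_ge0 (b + c); nra.
Qed.

Lemma Re_conjM_le z w : 2 * complex.Re (conjc z * w) <= sqnorm z + sqnorm w.
Proof.
rewrite ReM Re_conjc Im_conjc; case: z w => [a b] [c d]; rewrite /sqnorm /=.
by have := sqr_ge0 (a - c); have := sqr_ge0 (b - d); nra.
Qed.

End Complex_squared_norm.

(** * The space of square-integrable functions and its squared norm *)

Section L2_space.
Variables (R : realType) (mu : probability R R).
Implicit Types f g h : R -> R[i].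

Definition nsq f : R := \int[mu]_x sqnorm (f x).

Lemma nsq_ge0 f : 0 <= nsq f.
Proof. by apply: Rintegral_ge0 => x _; exact: sqnorm_ge0. Qed.

Lemma L2norm_sqr f : L2norm mu f ^+ 2 = nsq f.
Proof. by rewrite sqr_sqrtr// nsq_ge0. Qed.

Lemma nsq_le_L2norm f g (e : R) :
  L2norm mu f <= e * L2norm mu g -> nsq f <= e ^+ 2 * nsq g.
Proof.
move=> le_fg; rewrite -!L2norm_sqr -exprMn lerXn2r// ?nnegrE ?sqrtr_ge0//.
(* No sign is assumed of [e]; the right-hand side is nonnegative because it bounds a norm. *)
exact: le_trans (sqrtr_ge0 _) le_fg.
Qed.

Definition measurable_complex f :=
  measurable_fun setT (fun x => complex.Re (f x)) /\
  measurable_fun setT (fun x => complex.Im (f x)).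

Lemma L2_measurable f : L2 mu f -> measurable_complex f.
Proof. by case=> ? []. Qed.

Lemma L2_integrable f : L2 mu f -> mu.-integrable setT (EFin \o (fun x => sqnorm (f x))).
Proof. by case=> _ []. Qed.

Lemma measurable_sqnorm f : measurable_complex f ->
  measurable_fun setT (fun x => sqnorm (f x)).
Proof.
by case=> mR mI; apply: measurable_funD; exact: measurable_funX.
Qed.

Lemma L2_of_le f (F : R -> R) : measurable_complex f ->
  mu.-integrable setT (EFin \o F) -> (forall x, sqnorm (f x) <= F x) -> L2 mu f.
Proof.
move=> mf iF leF; case: (mf) => mR mI; split=> //; split=> //.
apply: le_integrable iF => //.
  by apply/measurable_EFinP; exact: measurable_sqnorm.
move=> x _ /=; rewrite lee_fin ger0_norm ?sqnorm_ge0//.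
exact: le_trans (leF x) (ler_norm _).
Qed.

Lemma measurable_complexD f g : measurable_complex f -> measurable_complex g ->
  measurable_complex (fun x => f x + g x).
Proof.
move=> [f1 f2] [g1 g2]; split.
  under eq_fun do rewrite ReD; exact: measurable_funD.
under eq_fun do rewrite ImD; exact: measurable_funD.
Qed.

Lemma measurable_complexM f g : measurable_complex f -> measurable_complex g ->
  measurable_complex (fun x => f x * g x).
Proof.
move=> [f1 f2] [g1 g2]; split.
  under eq_fun do rewrite ReM; apply: measurable_funB; exact: measurable_funM.
under eq_fun do rewrite ImM; apply: measurable_funD; exact: measurable_funM.
Qed.

Lemma measurable_complex_conj f : measurable_complex f ->
  measurable_complex (fun x => conjc (f x)).
Proof.
move=> [f1 f2]; split; first by under eq_fun do rewrite Re_conjc.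
under eq_fun do rewrite Im_conjc; exact: measurableT_comp.
Qed.

Lemma measurable_complex_cst (a : R[i]) : measurable_complex (fun=> a).
Proof. by split; exact: measurable_cst. Qed.

Lemma measurable_complex_indic (A : set R) : measurable A ->
  measurable_complex (\1_A : R -> R[i]).
Proof.
move=> mA; split; last by under eq_fun do rewrite Im_indic; exact: measurable_cst.
by under eq_fun do rewrite Re_indic; exact: measurable_indic.
Qed.

Lemma integrable_sqnormZ (k : R) f : L2 mu f ->
  mu.-integrable setT (EFin \o (fun x => (k * sqnorm (f x))%R)).
Proof.
move=> Lf; rewrite (_ : _ \o _ = fun x => k%:E * (sqnorm (f x))%:E)%E//.
by apply: integrableZl => //; exact: L2_integrable.
Qed.

Lemma integrable_sqnormD (k l : R) f g : L2 mu f -> L2 mu g ->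
  mu.-integrable setT (EFin \o (fun x => k * sqnorm (f x) + l * sqnorm (g x))).
Proof.
move=> Lf Lg; rewrite (_ : _ \o _ = (EFin \o (fun x => (k * sqnorm (f x))%R)) \+
  (EFin \o (fun x => (l * sqnorm (g x))%R)))%E//.
by apply: integrableD => //; exact: integrable_sqnormZ.
Qed.

Lemma L2D f g : L2 mu f -> L2 mu g -> L2 mu (fun x => f x + g x).
Proof.
move=> Lf Lg; apply: (@L2_of_le _ (fun x => 2 * sqnorm (f x) + 2 * sqnorm (g x))).
- by apply: measurable_complexD; exact: L2_measurable.
- exact: integrable_sqnormD.
- by move=> x; exact: sqnormD_le.
Qed.

Lemma L2Z (a : R[i]) f : L2 mu f -> L2 mu (fun x => a * f x).
Proof.
move=> Lf; apply: (@L2_of_le _ (fun x => sqnorm a * sqnorm (f x))).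
- by apply: measurable_complexM; [exact: measurable_complex_cst|exact: L2_measurable].
- exact: integrable_sqnormZ.
- by move=> x; rewrite sqnormM.
Qed.

Lemma L2B f g : L2 mu f -> L2 mu g -> L2 mu (fun x => f x - g x).
Proof.
move=> Lf /(L2Z (-1)) Lg; have := L2D Lf Lg.
by under eq_fun do rewrite mulN1r.
Qed.

Lemma L2_indic (A : set R) : measurable A -> L2 mu (\1_A : R -> R[i]).
Proof.
move=> mA; apply: (@L2_of_le _ (cst 1)); first exact: measurable_complex_indic.
  exact: finite_measure_integrable_cst.
by move=> x; rewrite sqnorm_indic indicE; case: (x \in A).
Qed.

Lemma L2_sum (I : Type) (s : seq I) (F : I -> R -> R[i]) :
  (forall i, L2 mu (F i)) -> L2 mu (fun x => \sum_(i <- s) F i x).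
Proof.
move=> LF; elim: s => [|i s IH].
  under eq_fun do rewrite big_nil.
  by have := L2_indic measurable0; rewrite indic0.
by under eq_fun do rewrite big_cons; exact: L2D.
Qed.

(** Plays the role of the triangle inequality. The factor 2 is harmless: it meets either an
    arbitrarily small bound or the starting constant of an iteration. *)
Lemma nsqD_le f g : L2 mu f -> L2 mu g ->
  nsq (fun x => f x + g x) <= 2 * nsq f + 2 * nsq g.
Proof.
move=> Lf Lg; rewrite /nsq -!RintegralZl//; try exact: L2_integrable.
rewrite -RintegralD//; try exact: integrable_sqnormZ.
apply: le_Rintegral => //; first exact/L2_integrable/L2D.
  exact: integrable_sqnormD.
by move=> x _; exact: sqnormD_le.
Qed.

Lemma nsqZ (a : R[i]) f : L2 mu f -> nsq (fun x => a * f x) = sqnorm a * nsq f.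
Proof.
move=> Lf; rewrite /nsq -RintegralZl//; last exact: L2_integrable.
by apply: eq_Rintegral => x _; rewrite sqnormM.
Qed.

Lemma nsq0_ae f : L2 mu f -> nsq f = 0 -> {ae mu, forall x, f x = 0}.
Proof.
move=> Lf f0.
have i0 : (\int[mu]_x `|(sqnorm (f x))%:E|)%E = 0%E.
  (* A real integral equal to 0 could come from [fine] of an infinite value; integrability excludes
     this. *)
  rewrite -[RHS]/(0%:E) -f0 /nsq /Rintegral fineK.
    by apply: eq_integral => x _; rewrite abse_EFin ger0_norm ?sqnorm_ge0.
  by apply: integrable_fin_num => //; exact: L2_integrable.
have mf : measurable_fun setT (EFin \o (fun x => sqnorm (f x))).
  by apply/measurable_EFinP; apply: measurable_sqnorm; exact: L2_measurable.
have := i0; move/(ae_eq_integral_abs mu measurableT mf).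
by apply: filterS => x /= /(_ I) [/sqnorm_eq0].
Qed.

Lemma nsq_ae_eq f g : measurable_complex f -> measurable_complex g ->
  {ae mu, forall x, f x = g x} -> nsq f = nsq g.
Proof.
move=> mf mg fg; congr fine; apply: ge0_ae_eq_integral => //.
- by apply/measurable_EFinP; exact: measurable_sqnorm.
- by apply/measurable_EFinP; exact: measurable_sqnorm.
- by move=> x _; rewrite lee_fin sqnorm_ge0.
- by move=> x _; rewrite lee_fin sqnorm_ge0.
- by apply: filterS fg => x -> _.
Qed.

Lemma Re_ip_self f : complex.Re (ip mu f f) = nsq f.
Proof.
apply: eq_Rintegral => x _; rewrite ReM Re_conjc Im_conjc /sqnorm; ring.
Qed.

Lemma Re_ipC f g : complex.Re (ip mu f g) = complex.Re (ip mu g f).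
Proof.
apply: eq_Rintegral => x _; rewrite !ReM !Re_conjc !Im_conjc; ring.
Qed.

Lemma integrable_conjM f g : L2 mu f -> L2 mu g ->
  mu.-integrable setT (EFin \o (fun x => complex.Re (conjc (f x) * g x))) /\
  mu.-integrable setT (EFin \o (fun x => complex.Im (conjc (f x) * g x))).
Proof.
move=> Lf Lg.
have [mR mI] := measurable_complexM
  (measurable_complex_conj (L2_measurable Lf)) (L2_measurable Lg).
split; apply: le_integrable (integrable_sqnormD 1 1 Lf Lg) => //;
  do ?exact/measurable_EFinP; move=> x _; rewrite lee_fin !mul1r.
  exact: le_trans (norm_Re_conjM _ _) (ler_norm _).
exact: le_trans (norm_Im_conjM _ _) (ler_norm _).
Qed.

(** The scalar is real, so conjugation in the first slot leaves it unchanged. *)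
Lemma ipZl (a : R) f g : L2 mu f -> L2 mu g ->
  ip mu (fun x => a%:C%C * f x) g = a%:C%C * ip mu f g.
Proof.
move=> Lf Lg; have [iR iI] := integrable_conjM Lf Lg.
rewrite /ip; simpc; rewrite -!RintegralZl//.
congr Complex; apply: eq_Rintegral => x _;
  by rewrite ?ReM ?ImM !Re_conjc !Im_conjc ReM ImM /=; ring.
Qed.

Lemma Re_ipDr f g h : L2 mu f -> L2 mu g -> L2 mu h ->
  complex.Re (ip mu f (fun x => g x + h x)) =
    complex.Re (ip mu f g) + complex.Re (ip mu f h).
Proof.
move=> Lf Lg Lh; have [ig _] := integrable_conjM Lf Lg.
have [ih _] := integrable_conjM Lf Lh.
transitivity (\int[mu]_x (complex.Re (conjc (f x) * g x) +
                          complex.Re (conjc (f x) * h x))).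
  by apply: eq_Rintegral => x _; rewrite mulrDr ReD.
by rewrite RintegralD.
Qed.

(** The integral of [sqnorm (f x - g x)] is nonnegative; this serves in place of Cauchy-Schwarz. *)
Lemma Re_ip_le f g : L2 mu f -> L2 mu g ->
  2 * complex.Re (ip mu f g) <= nsq f + nsq g.
Proof.
move=> Lf Lg; have [ifg _] := integrable_conjM Lf Lg.
rewrite -[complex.Re _]/(\int[mu]_x complex.Re (conjc (f x) * g x)) -RintegralZl//.
rewrite /nsq -RintegralD//; try exact: L2_integrable.
apply: le_Rintegral => //.
- rewrite (_ : _ \o _ = fun x => 2%:E * (complex.Re (conjc (f x) * g x))%:E)%E//.
  exact: integrableZl.
- have := integrable_sqnormD 1 1 Lf Lg.
  by rewrite /comp; under eq_fun do rewrite !mul1r.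
- by move=> x _; exact: Re_conjM_le.
Qed.

End L2_space.

(** * Self-similarity of the measure and contractivity of the maps [Ub] *)

Section Self_similar.
Variables (R : realType) (p : R) (mu : probability R R).
Hypotheses (p_gt0 : 0 < p) (p_lt1 : p < 1).
Hypothesis mu01 : mu `[0, 1]%classic = 1%E.
Hypothesis mu_inv : forall A : set R, measurable A ->
  mu A = (p%:E * mu (S false @^-1` A) + (1 - p)%:E * mu (S true @^-1` A))%E.
Implicit Types f g h : R -> R[i].

Lemma weight_gt0 b : 0 < weight p b.
Proof. by case: b; rewrite /weight ?subr_gt0. Qed.

Lemma ae01 : {ae mu, forall x, x \in `[0, 1]}.
Proof.
exists (~` `[0, 1]%classic); split; first exact: measurableC.
  by rewrite probability_setC ?mu01 ?subee.
by apply: subsetC => x.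
Qed.

(** The measure is the weighted sum of its two pushforwards. Listing the letter [b] first lets both
    maps [Ub p b] be treated uniformly. *)
Lemma integral_self_similar b (F : R -> \bar R) :
  measurable_fun setT F -> (forall x, 0 <= F x)%E ->
  (\int[mu]_x F x = (weight p b)%:E * \int[mu]_x F (S b x) +
     (weight p (~~ b))%:E * \int[mu]_x F (S (~~ b) x))%E.
Proof.
move=> mF F0.
suff H : (\int[mu]_x F x = p%:E * \int[mu]_x F (S false x) +
     (1 - p)%:E * \int[mu]_x F (S true x))%E.
  by case: b => /=; rewrite H // addeC.
pose w b' : {nonneg R} := NngNum (ltW (weight_gt0 b')).
have mS := @measurable_S R.
pose nu b' : {measure set R -> \bar R} :=
  pushforward mu (S b').
rewrite (eq_measure_integral (measure_add (mscale (w false) (nu mS false))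
  (mscale (w true) (nu mS true)))); last first.
  by move=> A mA _; rewrite [LHS]mu_inv//; exact/esym/measure_addE.
rewrite ge0_integral_measure_add// !ge0_integral_mscale//.
by rewrite !ge0_integral_pushforward//; exact: measurable_S.
Qed.

Lemma measurable_Ub b f : measurable_complex f -> measurable_complex (Ub p b f).
Proof.
move=> [fR fI]; apply: measurable_complexM.
  apply: measurable_complexM; first exact: measurable_complex_cst.
  by apply: measurable_complex_indic; exact: measurable_Cw.
have mS := @measurable_Sinv R b.
by split; [exact: (measurableT_comp fR mS)|exact: (measurableT_comp fI mS)].
Qed.

Lemma indic_Cw_cons b v (x : R) :
  \1_(Cw (b :: v)) x = \1_(Cw v) (Sinv b x) :> R[i].
Proof. by rewrite !indicE Cw_cons image_S. Qed.

Lemma Ub_S b f x :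
  Ub p b f (S b x) = ((Num.sqrt (weight p b))^-1)%:C%C * \1_(@Cantor R) x * f x.
Proof. by rewrite /Ub indic_Cw_cons SK Cw_nil. Qed.

Lemma Ub_S_other b f x : x \in `[0, 1] -> Ub p b f (S (~~ b) x) = 0.
Proof.
move=> x01; rewrite /Ub indicE memNset ?mulr0 ?mul0r//.
by move=> /Cw1_sub01[y y01]; exact: image_S_disjoint.
Qed.

Lemma weightV b : weight p b * (Num.sqrt (weight p b))^-1 ^+ 2 = 1.
Proof.
by rewrite exprVn sqr_sqrtr ?ltW ?weight_gt0// divff// gt_eqF ?weight_gt0.
Qed.

(** Of the two halves given by self-similarity, the one along [S (~~ b)] vanishes almost everywhere;
    along [S b] the weight cancels the squared normalisation, and the indicator of the Cantor set is
    bounded by 1. Working with the extended integral yields finiteness as well. *)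
Lemma integral_Ub_le b f : measurable_complex f ->
  (\int[mu]_x (sqnorm (Ub p b f x))%:E <= \int[mu]_x (sqnorm (f x))%:E)%E.
Proof.
move=> mf; have mS := @measurable_S R.
have mU : measurable_fun setT (fun x => (sqnorm (Ub p b f x))%:E).
  by apply/measurable_EFinP; apply: measurable_sqnorm; exact: measurable_Ub.
have U0 x : (0 <= (sqnorm (Ub p b f x))%:E)%E by rewrite lee_fin sqnorm_ge0.
have mUS b' : measurable_fun setT (fun x => (sqnorm (Ub p b f (S b' x)))%:E).
  exact: measurableT_comp mU (mS b').
rewrite (integral_self_similar b mU U0).
rewrite [X in (_ + _ * X)%E](_ : _ = 0%E) ?mule0 ?adde0; last first.
  rewrite -(integral0 mu setT); apply: ge0_ae_eq_integral => //.
  by apply: filterS ae01 => x x01 _; rewrite Ub_S_other// sqnorm0.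
rewrite -ge0_integralZl//; last by rewrite lee_fin ltW ?weight_gt0.
apply: ge0_le_integral => //.
- by move=> x _; rewrite mule_ge0// lee_fin ltW ?weight_gt0.
- exact: measurable_funeM.
- by apply/measurable_EFinP; exact: measurable_sqnorm.
- move=> x _; rewrite -EFinM lee_fin Ub_S !sqnormM sqnorm_real sqnorm_indic.
  rewrite [leLHS](_ : _ = weight p b * (Num.sqrt (weight p b))^-1 ^+ 2 *
    (\1_(@Cantor R) x * sqnorm (f x))); last by ring.
  rewrite weightV mul1r indicE ler_piMl ?sqnorm_ge0//.
  by case: (x \in _).
Qed.

Lemma L2_Ub b f : L2 mu f -> L2 mu (Ub p b f).
Proof.
move=> Lf; have mf := L2_measurable Lf.
have mU := @measurable_Ub b _ mf.
case: (mU) => mR mI; split=> //; split=> //; apply/integrableP; split.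
  by apply/measurable_EFinP; exact: measurable_sqnorm.
have /integrableP[_] := L2_integrable Lf; apply: le_lt_trans.
under eq_integral do rewrite gee0_abs ?lee_fin ?sqnorm_ge0//.
under [leRHS]eq_integral do rewrite gee0_abs ?lee_fin ?sqnorm_ge0//.
exact: integral_Ub_le.
Qed.

Lemma nsq_Ub_le b f : L2 mu f -> nsq mu (Ub p b f) <= nsq mu f.
Proof.
move=> Lf; apply: fine_le; last by apply: integral_Ub_le; exact: L2_measurable Lf.
- by apply: integrable_fin_num => //; apply: L2_integrable; exact: L2_Ub.
- by apply: integrable_fin_num => //; exact: L2_integrable.
Qed.

(* The ranges of [Ub p false] and [Ub p true] are orthogonal. *)
Lemma nsq_UbD_le f g : L2 mu f -> L2 mu g ->
  nsq mu (fun x => Ub p false f x + Ub p true g x) <= nsq mu f + nsq mu g.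
Proof.
move=> Lf Lg; rewrite (_ : nsq _ _ = nsq mu (Ub p false f) + nsq mu (Ub p true g)).
  by rewrite lerD ?nsq_Ub_le.
rewrite /nsq -RintegralD//; try by apply: L2_integrable; exact: L2_Ub.
apply: eq_Rintegral => x _.
(* At every point at least one of the two terms vanishes, so the squared modulus is additive
   there. *)
have [xC|xC] := pselect (Cw [:: false] x).
  rewrite (_ : Ub p true g x = 0) ?sqnorm0 ?addr0//.
  rewrite /Ub indicE memNset ?mulr0 ?mul0r//.
  move=> /Cw1_sub01[y y01 yx]; have [z z01 zx] := Cw1_sub01 xC.
  by apply: (@image_S_disjoint _ true y z) => //; rewrite yx zx.
rewrite (_ : Ub p false f x = 0) ?sqnorm0 ?add0r//.
by rewrite /Ub indicE memNset ?mulr0 ?mul0r.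
Qed.

End Self_similar.

Lemma eq0_of_le_sqr (R : rcfType) (x y : R) : 0 <= x -> 0 <= y ->
  (forall e, 0 < e -> x <= e ^+ 2 * y) -> x = 0.
Proof.
move=> x0 y0 le_xy; apply/eqP; rewrite eq_le x0 andbT.
apply/ler_addgt0Pl => e e0; rewrite addr0.
have y1 : 0 < y + 1 by rewrite ltr_wpDl.
(* The hypothesis is used at the square root of this number, giving the bound [e * y / (y + 1)], at
   most [e]; the added 1 covers [y = 0]. *)
have d0 : 0 < e / (y + 1) by rewrite divr_gt0.
have := le_xy (Num.sqrt (e / (y + 1))); rewrite sqrtr_gt0 => /(_ d0).
rewrite (sqr_sqrtr (ltW d0)) => /le_trans; apply.
by rewrite mulrAC ler_pdivrMr// ler_pM2l// lerDl.
Qed.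

(** * The adjoints of [Ub] and the contraction property of [Psi] *)

Section Fixed_point.
Import numFieldNormedType.Exports.
Variables (R : realType) (p : R) (mu : probability R R).
Hypotheses (p_gt0 : 0 < p) (p_lt1 : p < 1).
Hypothesis mu01 : mu `[0, 1]%classic = 1%E.
Hypothesis mu_inv : forall A : set R, measurable A ->
  mu A = (p%:E * mu (S false @^-1` A) + (1 - p)%:E * mu (S true @^-1` A))%E.
Variable Us : bool -> op R.
Hypothesis adjU : forall b, is_adjoint mu (Ub p b) (Us b).
Implicit Types (f g : R -> R[i]) (T : op R).

Local Notation nsq := (nsq mu).
Local Notation Psi := (Psi mu p (Us false) (Us true)).

Lemma L2_Us b f : L2 mu f -> L2 mu (Us b f).
Proof. by have [[+ _ _ _] _] := adjU b; apply. Qed.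

Lemma nsq_Us b f : L2 mu f ->
  nsq (Us b f) = complex.Re (ip mu f (Ub p b (Us b f))).
Proof.
move=> Lf; have [_ adj] := adjU b; have LU := L2_Us b Lf.
by rewrite Re_ipC adj// Re_ip_self.
Qed.

Lemma nsq_Us_le f : L2 mu f -> nsq (Us false f) + nsq (Us true f) <= nsq f.
Proof.
move=> Lf; have L0 := L2_Us false Lf; have L2t := L2_Us true Lf.
have LU0 := L2_Ub p_gt0 p_lt1 mu01 mu_inv false L0.
have LU2 := L2_Ub p_gt0 p_lt1 mu01 mu_inv true L2t.
(* Writing A for the left-hand side and h for the sum of the [Ub] terms, 2A is at most [nsq f] plus
   the squared norm of h, and the latter is at most A. *)
have := Re_ip_le Lf (L2D LU0 LU2); rewrite Re_ipDr// -!nsq_Us//.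
have := nsq_UbD_le p_gt0 p_lt1 mu01 mu_inv L0 L2t.
by lra.
Qed.

Lemma Ub_scale b (a : R[i]) f : Ub p b (fun x => a * f x) = (fun x => a * Ub p b f x).
Proof. by apply/funext => x; rewrite /Ub mulrCA. Qed.

Lemma PsiE T f x : Psi T f x = Pphi mu f x
  + (weight p false)%:C%C * Ub p false (T (Us false f)) x
  + (weight p true)%:C%C * Ub p true (T (Us true f)) x.
Proof. by []. Qed.

(** The projection terms cancel; the weights are moved inside [Ub] so that [nsq_UbD_le] applies as
    it stands. *)
Lemma Psi_sub T1 T2 f (g := fun b x => T1 (Us b f) x - T2 (Us b f) x) :
  (fun x => Psi T1 f x - Psi T2 f x) =
  (fun x => Ub p false (fun y => (weight p false)%:C%C * g false y) x +
            Ub p true (fun y => (weight p true)%:C%C * g true y) x).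
Proof.
by apply/funext => x; rewrite !Ub_scale /g !PsiE /Ub; ring.
Qed.

(** A polynomial bound for both squared weights, free of any maximum: it exceeds the square of one
    weight by exactly the other weight. *)
Definition rate : R := 1 - p * (1 - p).

Lemma rate_ge0 : 0 <= rate.
Proof. by rewrite /rate; nra. Qed.

Lemma rate_lt1 : rate < 1.
Proof. by rewrite ltrBlDr ltrDl mulr_gt0 ?subr_gt0. Qed.

Lemma weight_sqr_le b : weight p b ^+ 2 <= rate.
Proof.
rewrite -subr_ge0 (_ : _ - _ = weight p (~~ b)) ?ltW ?weight_gt0//.
by case: b; rewrite /weight /rate /=; ring.
Qed.

Lemma L2_Psi_sub T1 T2 f :
  (forall f, L2 mu f -> L2 mu (T1 f)) -> (forall f, L2 mu f -> L2 mu (T2 f)) ->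
  L2 mu f -> L2 mu (fun x => Psi T1 f x - Psi T2 f x).
Proof.
move=> LT1 LT2 Lf; rewrite Psi_sub.
have Lg b : L2 mu (fun x => T1 (Us b f) x - T2 (Us b f) x).
  by have LU := L2_Us b Lf; apply: L2B; [exact: LT1|exact: LT2].
by apply: L2D; apply: L2_Ub => //; exact: L2Z.
Qed.

Lemma nsq_Psi_sub T1 T2 f (M : R) :
  (forall f, L2 mu f -> L2 mu (T1 f)) -> (forall f, L2 mu f -> L2 mu (T2 f)) ->
  0 <= M ->
  (forall f, L2 mu f -> nsq (fun x => T1 f x - T2 f x) <= M * nsq f) ->
  L2 mu f -> nsq (fun x => Psi T1 f x - Psi T2 f x) <= rate * M * nsq f.
Proof.
move=> LT1 LT2 M0 leM Lf; rewrite Psi_sub.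
have Lg b : L2 mu (fun x => T1 (Us b f) x - T2 (Us b f) x).
  by have LU := L2_Us b Lf; apply: L2B; [exact: LT1|exact: LT2].
apply: le_trans
  (nsq_UbD_le p_gt0 p_lt1 mu01 mu_inv (L2Z _ (Lg false)) (L2Z _ (Lg true))) _.
rewrite !nsqZ// !sqnorm_real.
have le0 := ler_pM (sqr_ge0 _) (nsq_ge0 _ _) (weight_sqr_le false)
  (leM _ (L2_Us false Lf)).
have le2 := ler_pM (sqr_ge0 _) (nsq_ge0 _ _) (weight_sqr_le true)
  (leM _ (L2_Us true Lf)).
apply: le_trans (lerD le0 le2) _.
(* The two adjoint norms are bounded jointly; separate bounds would cost a factor 2 and could lose
   the contraction. *)
by rewrite !mulrA -mulrDr ler_wpM2l ?nsq_Us_le// mulr_ge0 ?rate_ge0.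
Qed.

(** * The recursion for [K] *)

Lemma L2_K m f : L2 mu (K mu m f).
Proof.
apply: L2_sum => k; apply: L2_sum => u; apply: L2Z.
by apply: L2_indic; exact: measurable_Cw.
Qed.

(** Composing with [Sinv b] already gives the indicator of the cylinder of [b :: v]; the extra
    indicator of [Cw [:: b]] is absorbed by nesting. *)
Lemma Ub_indic b v (x : R) :
  Ub p b (\1_(Cw v)) x = ((Num.sqrt (weight p b))^-1)%:C%C * \1_(Cw (b :: v)) x.
Proof.
rewrite /Ub -indic_Cw_cons -mulrA; congr (_ * _); rewrite !indicE.
have [xC|xC] := boolP (x \in Cw (b :: v)); last by rewrite mulr0.
by rewrite mem_set ?mulr1//; apply: (@Cw_cons_sub _ b v); rewrite inE in xC.
Qed.

Lemma ip_indic_Us b v f : L2 mu f ->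
  ip mu (\1_(Cw v)) (Us b f) =
    ((Num.sqrt (weight p b))^-1)%:C%C * ip mu (\1_(Cw (b :: v))) f.
Proof.
move=> Lf; have [_ adj] := adjU b.
have LC w : L2 mu (\1_(@Cw R w) : R -> R[i]).
  by apply: L2_indic; exact: measurable_Cw.
rewrite -adj// -ipZl//; congr ip; apply/funext => x; exact: Ub_indic.
Qed.

(** One normalising factor comes from the function, the other from the inner product; their product
    is the inverse of the weight. *)
Lemma weight_Ub_term b v f x : L2 mu f ->
  (weight p b)%:C%C * (ip mu (\1_(Cw v)) (Us b f) * Ub p b (\1_(Cw v)) x) =
  ip mu (\1_(Cw (b :: v))) f * \1_(Cw (b :: v)) x.
Proof.
move=> Lf; rewrite Ub_indic ip_indic_Us//.
set s := Num.sqrt _; set c := ip _ _ _; set i := \1_ _ _.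
have sE : (weight p b)%:C%C * (s^-1)%:C%C ^+ 2 = 1 :> R[i].
  by rewrite -rmorphXn -rmorphM weightV.
transitivity ((weight p b)%:C%C * (s^-1)%:C%C ^+ 2 * (c * i)); first by ring.
by rewrite sE mul1r.
Qed.

Lemma weight_Ub_K b m f x : L2 mu f ->
  (weight p b)%:C%C * Ub p b (K mu m (Us b f)) x =
  \sum_(k < m.+1) \sum_(v : k.-tuple bool)
    ip mu (\1_(Cw (b :: v))) f * \1_(Cw (b :: v)) x.
Proof.
move=> Lf; rewrite /Ub /K !mulr_sumr; apply: eq_bigr => k _.
rewrite !mulr_sumr; apply: eq_bigr => v _.
by rewrite -weight_Ub_term// /Ub; ring.
Qed.

Lemma sum_tuple_cons (V : nmodType) k (G : seq bool -> V) :
  \sum_(u : k.+1.-tuple bool) G u =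
  \sum_(v : k.-tuple bool) G (false :: v) + \sum_(v : k.-tuple bool) G (true :: v).
Proof.
rewrite (reindex (fun bv : bool * k.-tuple bool => [tuple of bv.1 :: bv.2])) /=.
  rewrite -(pair_big xpredT xpredT (fun b (v : k.-tuple bool) => G (b :: v))) /=.
  by rewrite big_bool addrC.
exists (fun u => (thead u, [tuple of behead u])) => [[b v] _|u _] /=.
  by congr pair; apply: val_inj.
by case/tupleP: u => b v; apply: val_inj.
Qed.

Lemma K0 f : K mu 0 f = Pphi mu f.
Proof.
apply/funext => x; rewrite /K big_ord1 (big_pred1 [tuple]) /=; last first.
  by move=> u; apply/esym/eqP; exact: tuple0.
by rewrite Cw_nil.
Qed.

Lemma K_succ m f : L2 mu f -> K mu m.+1 f = Psi (K mu m) f.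
Proof.
move=> Lf; apply/funext => x.
rewrite PsiE -addrA !weight_Ub_K// -K0 /K.
(* The empty word yields the projection term; words of length [k + 1] are split by their first
   letter. *)
rewrite [LHS]big_ord_recl [in RHS]big_ord1; congr (_ + _).
rewrite -big_split; apply: eq_bigr => k _.
exact: (@sum_tuple_cons R[i] k (fun u => ip mu (\1_(Cw u)) f * \1_(Cw u) x)).
Qed.

(** The recursion is an equality of functions, not only almost everywhere, so the induction
    hypothesis at [Us b f] rewrites directly under [Ub]. *)
Lemma K_iter m f : L2 mu f -> K mu m f = iter m Psi (Pphi mu) f.
Proof.
elim: m f => [|m IH] f Lf; first exact: K0.
by rewrite K_succ//= /Defs.Psi !IH//; exact: L2_Us.
Qed.

(** * Passage to the limit and uniqueness of the fixed point *)

Lemma ae_of_nsq_sub f g : L2 mu (fun x => f x - g x) ->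
  nsq (fun x => f x - g x) = 0 -> Defs.ae_eq mu f g.
Proof.
by move=> L0 /(nsq0_ae L0); apply: filterS => x /eqP; rewrite subr_eq0 => /eqP.
Qed.

Lemma fixed_point_lim Kinf : bounded_op mu Kinf -> opnorm_cvg mu (K mu) Kinf ->
  op_eq mu Kinf (Psi Kinf).
Proof.
move=> [LK _ _ _] cvgK f Lf.
have L1 m : L2 mu (fun x => K mu m f x - Kinf f x).
  by apply: L2B; [exact: L2_K|exact: LK].
have L2m m := L2_Psi_sub (fun g _ => L2_K m g) LK Lf.
(* Inserts [K mu m.+1 f], which equals [Psi (K mu m) f], between the two sides. *)
have split_sub m : (fun x => Kinf f x - Psi Kinf f x) =
    (fun x => - 1 * (K mu m.+1 f x - Kinf f x) + (Psi (K mu m) f x - Psi Kinf f x)).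
  by apply/funext => x; rewrite K_succ//; ring.
apply: ae_of_nsq_sub.
  by rewrite (split_sub 0%N); apply: L2D => //; exact: L2Z.
(* The 4 is 2 + 2 from [nsqD_le]: each of the two pieces is at most [e ^+ 2 * nsq f], the second
   because [rate] is below 1. *)
apply: (@eq0_of_le_sqr _ _ (4 * nsq f)); rewrite ?mulr_ge0 ?nsq_ge0// => e e0.
have [N leN] := cvgK e e0.
have le_nsq m g : (N <= m)%N -> L2 mu g ->
    nsq (fun x => K mu m g x - Kinf g x) <= e ^+ 2 * nsq g.
  by move=> Nm Lg; apply: nsq_le_L2norm; exact: leN.
rewrite (split_sub N).
have LZ : L2 mu (fun x => - 1 * (K mu N.+1 f x - Kinf f x)) by exact: L2Z.
apply: le_trans (nsqD_le LZ (L2m N)) _.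
rewrite nsqZ// sqnormN (sqnorm_real 1) expr1n mul1r.
have := le_nsq _ _ (leqnSn N) Lf.
have := nsq_Psi_sub (fun g _ => L2_K N g) LK (sqr_ge0 e)
  (fun g Lg => le_nsq N g (leqnn N) Lg) Lf.
have : rate * (e ^+ 2 * nsq f) <= e ^+ 2 * nsq f.
  by rewrite ler_piMl ?mulr_ge0 ?sqr_ge0 ?nsq_ge0 ?ltW ?rate_lt1.
by rewrite !mulrA; lra.
Qed.

Lemma fixed_point_unique T1 T2 : bounded_op mu T1 -> bounded_op mu T2 ->
  op_eq mu T1 (Psi T1) -> op_eq mu T2 (Psi T2) -> op_eq mu T1 T2.
Proof.
move=> [LT1 _ _ [c1 bT1]] [LT2 _ _ [c2 bT2]] fixT1 fixT2.
(* Crude bound from the two operator bounds and [nsqD_le]; it starts the iteration of the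
   contraction estimate. *)
pose M := 2 * c1 ^+ 2 + 2 * c2 ^+ 2.
have M0 : 0 <= M by have := sqr_ge0 c1; have := sqr_ge0 c2; rewrite /M; lra.
have LT f : L2 mu f -> L2 mu (fun x => T1 f x - T2 f x).
  by move=> Lf; apply: L2B; [exact: LT1|exact: LT2].
have contr n f : L2 mu f ->
    nsq (fun x => T1 f x - T2 f x) <= rate ^+ n * M * nsq f.
  elim: n f => [|n IH] f Lf.
    have LN : L2 mu (fun x => - 1 * T2 f x) by apply: L2Z; exact: LT2.
    have := nsqD_le (LT1 _ Lf) LN.
    under eq_fun do rewrite mulN1r.
    move=> /le_trans; apply; rewrite nsqZ//; last exact: LT2.
    rewrite sqnormN (sqnorm_real 1) expr1n mul1r expr0 mul1r /M.
    have := nsq_le_L2norm (bT1 _ Lf); have := nsq_le_L2norm (bT2 _ Lf).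
    by lra.
  (* The fixed-point equations hold only almost everywhere, so they are substituted inside the
     integral. *)
  have -> : nsq (fun x => T1 f x - T2 f x) = nsq (fun x => Psi T1 f x - Psi T2 f x).
    apply: nsq_ae_eq.
    - exact: L2_measurable (LT _ Lf).
    - exact: L2_measurable (L2_Psi_sub LT1 LT2 Lf).
    - by apply: filterS2 (fixT1 _ Lf) (fixT2 _ Lf) => x -> ->.
  rewrite exprS -(mulrA rate); apply: nsq_Psi_sub => //.
  by rewrite mulr_ge0// exprn_ge0// rate_ge0.
move=> f Lf; apply: ae_of_nsq_sub; first exact: LT.
apply/eqP; rewrite eq_le nsq_ge0 andbT.
have cvg0 : rate ^+ n * (M * nsq f) @[n --> \oo] --> (0 : R).
  rewrite -[X in _ --> X](mul0r (M * nsq f)); apply: cvgMr_tmp.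
  by apply: cvg_expr; rewrite ger0_norm ?rate_ge0 ?rate_lt1.
apply: (cvgr_to_ge cvg0); apply: nearW => n; rewrite mulrA; exact: contr.
Qed.

End Fixed_point.

Theorem theorem6p3 (R : realType) (p : R) (mu : probability R R)
  (U0s U2s Kinf : op R) :
  0 < p -> p < 1 ->
  (* mu is mu_p: a Borel probability measure on [0,1] with
     mu_p = p mu_p o S_0^{-1} + (1-p) mu_p o S_2^{-1} *)
  mu `[0, 1]%classic = 1%E ->
  (forall A : set R, measurable A ->
     mu A = (p%:E * mu (S false @^-1` A) + (1 - p)%:E * mu (S true @^-1` A))%E) ->
  (* U0s = U_0^*, U2s = U_2^* (Hilbert adjoints on L^2(mu_p)) *)
  is_adjoint mu (U0 p) U0s -> is_adjoint mu (U2 p) U2s ->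
  (* K_infty = lim K_m in operator norm *)
  bounded_op mu Kinf -> opnorm_cvg mu (K mu) Kinf ->
  [/\ (* (1) *)
      (forall m : nat, op_eq mu (K mu m.+1) (Psi mu p U0s U2s (K mu m))
                    /\ op_eq mu (K mu m) (iter m (Psi mu p U0s U2s) (Pphi mu))),
      (* (2) *)
      op_eq mu Kinf (Psi mu p U0s U2s Kinf)
    & (* (3) *)
      forall T : op R, bounded_op mu T ->
        op_eq mu T (Psi mu p U0s U2s T) -> op_eq mu T Kinf].
Proof.
move=> p_gt0 p_lt1 mu01 mu_inv adj0 adj2 bK cvgK.
pose Us b := if b then U2s else U0s.
have adjU b : is_adjoint mu (Ub p b) (Us b) by case: b.
have fixK : op_eq mu Kinf (Psi mu p U0s U2s Kinf).
  exact: (fixed_point_lim p_gt0 p_lt1 mu01 mu_inv adjU bK cvgK).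
split=> // [m|T bT fixT].
  split=> f Lf; apply: filterE => x.
    by rewrite (K_succ p_gt0 p_lt1 adjU).
  by rewrite (K_iter p_gt0 p_lt1 adjU).
exact: (fixed_point_unique p_gt0 p_lt1 mu01 mu_inv adjU bT bK fixT fixK).
Qed.
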